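(* Let $r\ge1$ and let $(T_{\alpha,j,k})$, indexed by $\alpha\in\{0,\dots,r+1\}$, $j,k\in\mathbb Z$ with $\alpha+j+k$ even, satisfy the $A_r$ $T$-system $$T_{\alpha,j,k+1}T_{\alpha,j,k-1}=T_{\alpha,j+1,k}T_{\alpha,j-1,k}+T_{\alpha+1,j,k}T_{\alpha-1,j,k}\quad(1\le\alpha\le r),\qquad T_{0,j,k}=T_{r+1,j,k}=1.$$ Let $\mathbf k=(k_{\alpha,j})_{1\le\alpha\le r,\,j\in\mathbb Z}$ be a stepped surface, i.e. $k_{\alpha,j}\in\mathbb Z$, $\alpha+j+k_{\alpha,j}$ even, $k_{\alpha+1,j}-k_{\alpha,j}=\pm1$ and $k_{\alpha,j+1}-k_{\alpha,j}=\pm1$, and assume moreover that $\mathbf k$ is 2-periodic: $k_{\alpha,j+2}=k_{\alpha,j}$ for all $\alpha,j$. Regard the initial data $\mathbf x_{\mathbf k}=\{T_{\alpha,j,k_{\alpha,j}}\}_{1\le\alpha\le r,\,j\in\mathbb Z}$ as independent commuting indeterminates (the system then determines all $T_{\alpha,j,k}$). Then every $T_{\alpha,j,k}$ ($1\le\alpha\le r$) is a Laurent polynomial in finitely many variables of $\mathbf x_{\mathbf k}$ with non-negative integer coefficients. *)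

(* Defs.v *)
From HB Require Import structures.
From mathcomp Require Import all_boot all_order all_algebra.
Set Implicit Arguments. Unset Strict Implicit. Unset Printing Implicit Defensive.
Import Order.TTheory GRing.Theory Num.Theory.
Local Open Scope ring_scope.

Definition even_idx (a : nat) (j k : int) : bool := (2 %| (a%:Z + j + k))%Z.

Definition stepped_surface (r : nat) (kk : nat -> int -> int) : Prop :=
  [/\ forall a j, (1 <= a <= r)%N -> even_idx a j (kk a j),
      forall a j, (1 <= a < r)%N ->
        kk a.+1 j - kk a j = 1 \/ kk a.+1 j - kk a j = -1 &
      forall a j, (1 <= a <= r)%N ->
        kk a (j + 1) - kk a j = 1 \/ kk a (j + 1) - kk a j = -1].

Definition two_periodic (r : nat) (kk : nat -> int -> int) : Prop :=
  forall a j, (1 <= a <= r)%N -> kk a (j + 2) = kk a j.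

(* the A_r T-system (values at points with a+j+k even are the relevant ones) *)
Definition Tsystem (F : fieldType) (r : nat) (T : nat -> int -> int -> F) : Prop :=
  [/\ forall a j k, (1 <= a <= r)%N -> ~~ even_idx a j k ->
        T a j (k + 1) * T a j (k - 1) =
        T a (j + 1) k * T a (j - 1) k + T a.+1 j k * T a.-1 j k,
      forall j k, even_idx 0 j k -> T 0%N j k = 1 &
      forall j k, even_idx r.+1 j k -> T r.+1 j k = 1].

(* Formal Laurent polynomials with non-negative integer coefficients in
   variables x_{a,j}: a finite list of terms (c, m), c : nat the coefficient,
   m a finite list of (a, j, e) meaning the factor x_{a,j}^e, e : int. *)
Definition laurent := seq (nat * seq (nat * int * int)).

Definition leval (F : fieldType) (x : nat -> int -> F) (P : laurent) : F :=
  \sum_(m <- P) (m.1)%:R * \prod_(v <- m.2) (x v.1.1 v.1.2) ^ v.2.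

Definition lvars_in (r : nat) (P : laurent) : bool :=
  all (fun m => all (fun v => (1 <= v.1.1 <= r)%N) m.2) P.

(* Main.v *)
Require Import Defs.
From HB Require Import structures.
From mathcomp Require Import all_boot all_order all_algebra.
From mathcomp Require Import zify ring.
From Stdlib Require Import FunctionalExtensionality.
Import Order.TTheory GRing.Theory Num.Theory.
Local Open Scope ring_scope.

(* Attach to each unit step of a stepped surface at level [b], from the value [x]
   on the left to [y] on the right, the 2x2 matrix
     V = [[x/y, v/y], [0, 1]] if the step goes up,
     U = [[1, 0], [u/y, x/y]] if it goes down,
   where [v] and [u] are values at levels [b-1] and [b+1].  One step of the
   T-system is exactly the exchange U V = V' U', so the ordered product of these
   matrices, acting on sites [b], [b+1] of an (r+1)-dimensional space, over all
   steps between two columns is unchanged when the surface is modified strictly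
   between them.  Raise the surface to one through the target point (a, j, h),
   with slope +1 at level [a] to the left of it and -1 to the right: there the
   minor of the product on the rows and columns [a+1..r+1] factorises into a
   monomial containing T_{a,j,h}.  On the initial surface the same minor is a
   polynomial with non-negative coefficients in the entries of the matrices,
   hence a positive Laurent polynomial.  Points below the surface reduce to
   points above it by k -> -k. *)

(** * Operators on the exterior algebra *)

Definition config := nat -> bool.

Definition swap (b : nat) (S : config) : config :=
  fun n => if n == b then S b.+1 else if n == b.+1 then S b else S n.

Lemma swapL b S : swap b S b = S b.+1.
Proof. by rewrite /swap eqxx. Qed.

Lemma swapR b S : swap b S b.+1 = S b.
Proof. by rewrite /swap eqxx gtn_eqF. Qed.

Lemma swap_out b S n : n != b -> n != b.+1 -> swap b S n = S n.
Proof. by rewrite /swap => /negPf-> /negPf->. Qed.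

Lemma swapK b : involutive (swap b).
Proof.
move=> S; apply: functional_extensionality => n.
have [->|nb] := eqVneq n b; first by rewrite swapL swapR.
have [->|nb1] := eqVneq n b.+1; first by rewrite swapR swapL.
by rewrite !swap_out.
Qed.

Lemma swap_comm b c S : (b.+1 < c)%N ->
  swap b (swap c S) = swap c (swap b S).
Proof.
move=> bc; apply: functional_extensionality => n; rewrite /swap.
do ![case: eqP => //= ?]; lia.
Qed.

Record mat2 (F : fieldType) := Mat2 { m00 : F; m01 : F; m10 : F; m11 : F }.
Arguments Mat2 {F}.
Arguments m00 {F}.
Arguments m01 {F}.
Arguments m10 {F}.
Arguments m11 {F}.

(* The action of [G] on sites [b], [b+1] in the whole exterior algebra; [w] gives
   the coordinates on the basis of wedge products indexed by the set [S] of
   occupied sites.  No sign occurs because the two sites are adjacent.  Working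
   there replaces minors and the Cauchy-Binet formula. *)
Definition fock {F : fieldType} (b : nat) (G : mat2 F) (w : config -> F)
    : config -> F := fun S =>
  match S b, S b.+1 with
  | false, false => w S
  | true, true => (m00 G * m11 G - m01 G * m10 G) * w S
  | true, false => m00 G * w S + m01 G * w (swap b S)
  | false, true => m10 G * w (swap b S) + m11 G * w S
  end.

Definition mul2 {F : fieldType} (G H : mat2 F) : mat2 F :=
  Mat2 (m00 G * m00 H + m01 G * m10 H)
         (m00 G * m01 H + m01 G * m11 H)
         (m10 G * m00 H + m11 G * m10 H)
         (m10 G * m01 H + m11 G * m11 H).

Definition one2 {F : fieldType} : mat2 F := Mat2 1 0 0 1.

Lemma fock1 {F : fieldType} b (w : config -> F) : fock b one2 w = w.
Proof.
apply: functional_extensionality => S; rewrite /fock /=.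
by case: (S b); case: (S b.+1) => //; ring.
Qed.

Lemma fockM {F : fieldType} b (G H : mat2 F) w :
  fock b G (fock b H w) = fock b (mul2 G H) w.
Proof.
apply: functional_extensionality => S; rewrite /fock /= swapL swapR swapK.
by case: (S b); case: (S b.+1) => //; ring.
Qed.

Lemma fock_comm {F : fieldType} b c (G H : mat2 F) w : (b.+1 < c)%N ->
  fock b G (fock c H w) = fock c H (fock b G w).
Proof.
move=> bc; apply: functional_extensionality => S.
rewrite /fock !(swap_out b S) -?(swap_comm b c) //; try lia.
rewrite !(swap_out c S); try lia.
by case: (S b); case: (S b.+1); case: (S c); case: (S c.+1) => //; ring.
Qed.

(** Acting on column vectors, the first matrix changes only row [b] and the second only row [b.+2];
    both read row [b.+1], which neither changes. *)
Lemma fock_up_down {F : fieldType} b (A B C D : F) w :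
  fock b (Mat2 A B 0 1) (fock b.+1 (Mat2 1 0 C D) w) =
  fock b.+1 (Mat2 1 0 C D) (fock b (Mat2 A B 0 1) w).
Proof.
apply: functional_extensionality => S.
rewrite /fock /= !(swapL, swapR) (swap_out b S b.+2) ?(swap_out b.+1 S b);
  try lia.
by case: (S b); case: (S b.+1); case: (S b.+2) => //; ring.
Qed.

(** Only row [m.+1] changes, and both sides give it the entries [a' / b], [a * a' / (b * b')],
    [a / b'] in columns [m], [m.+1], [m.+2]. *)
Lemma fock_down_up {F : fieldType} m (a b a' b' : F) w : b != 0 -> b' != 0 ->
  fock m (Mat2 1 0 (a' / b) (a / b))
    (fock m.+1 (Mat2 (a' / b') (b / b') 0 1) w) =
  fock m.+1 (Mat2 (a' / b') (a / b') 0 1)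
    (fock m (Mat2 1 0 (b' / b) (a / b)) w).
Proof.
move=> b0 b'0; apply: functional_extensionality => S.
rewrite /fock /= !(swapL, swapR) (swap_out m S m.+2) ?(swap_out m.+1 S m);
  try lia.
by case: (S m); case: (S m.+1); case: (S m.+2) => //; field; rewrite ?b0 ?b'0.
Qed.

(** By the relation, both products equal [[b/c, v/c], [u/c, b'/c]]. Here [a] and [c] are the left
    and right values, [b] and [b'] the old and new middle ones. *)
Lemma fock_mutation {F : fieldType} m (a b b' c u v : F) w :
  b != 0 -> b' != 0 -> c != 0 -> b' * b = c * a + u * v ->
  fock m (Mat2 1 0 (u / b) (a / b)) (fock m (Mat2 (b / c) (v / c) 0 1) w) =
  fock m (Mat2 (a / b') (v / b') 0 1) (fock m (Mat2 1 0 (u / c) (b' / c)) w).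
Proof.
move=> b0 b'0 c0 E; rewrite !fockM; congr (fock m _ w); rewrite /mul2 /=.
have E1 : a / b = b' / c - u / b * (v / c).
  apply: (mulIf (mulf_neq0 b0 c0)); rewrite mulrBl.
  rewrite (_ : a / b * (b * c) = c * a); last by field.
  rewrite (_ : b' / c * (b * c) = b' * b); last by field.
  by rewrite E; field; rewrite c0.
have E2 : a / b' = b / c - v / b' * (u / c).
  apply: (mulIf (mulf_neq0 b'0 c0)); rewrite mulrBl.
  rewrite (_ : a / b' * (b' * c) = c * a); last by field.
  rewrite (_ : b / c * (b' * c) = b' * b); last by field.
  by rewrite E; field; rewrite c0.
by congr Mat2; rewrite ?E1 ?E2; field; rewrite ?b0 ?b'0 ?c0.
Qed.

(* The product of the [X b], 1 <= b <= n: [c b] says that [X b] stands to the right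
   of [X b.-1].  As distant factors commute, these bits determine the product. *)
Fixpoint word {F : fieldType} (X : nat -> mat2 F) (c : nat -> bool) (n : nat)
    (w : config -> F) : config -> F :=
  if n is m.+1 then
    if c m.+1 then word X c m (fock m.+1 (X m.+1) w)
    else fock m.+1 (X m.+1) (word X c m w)
  else w.

Lemma eq_word {F : fieldType} (X X' : nat -> mat2 F) (c c' : nat -> bool) n w :
  (forall b, (1 <= b <= n)%N -> X b = X' b) ->
  (forall b, (2 <= b <= n)%N -> c b = c' b) ->
  word X c n w = word X' c' n w.
Proof.
elim: n w => //= n IH w EX Ec; rewrite EX ?leqnn //.
have EI w' : word X c n w' = word X' c' n w'.
  by apply: IH => b /andP[? ?]; [apply: EX | apply: Ec]; lia.
case: n IH EX Ec EI => [|n] IH EX Ec EI; first by case: ifP; case: ifP.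
by rewrite !EI Ec ?leqnn.
Qed.

Lemma word_comm {F : fieldType} (X : nat -> mat2 F) c n b G w : (n.+1 < b)%N ->
  fock b G (word X c n w) = word X c n (fock b G w).
Proof.
elim: n w => //= n IH w nb; case: (c n.+1).
  by rewrite IH; [rewrite (fock_comm n.+1) | lia].
by rewrite -(fock_comm n.+1 b) // IH //; lia.
Qed.

Definition upd {A : Type} (X : nat -> A) (b : nat) (G : A) : nat -> A :=
  fun n => if n == b then G else X n.


Lemma updE {A : Type} (X : nat -> A) b G : upd X b G b = G.
Proof. by rewrite /upd eqxx. Qed.

Lemma upd_out {A : Type} (X : nat -> A) b G n : n != b -> upd X b G n = X n.
Proof. by rewrite /upd => /negPf->. Qed.

(** The two bits put [X b] to the right of [X b.-1] and [X b.+1], the only factors it may fail to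
    commute with, so it can move to the right end; [one2] fills its place. *)
Lemma word_last {F : fieldType} (X : nat -> mat2 F) (c : nat -> bool) n b w : (1 <= b <= n)%N ->
  c b -> ~~ c b.+1 ->
  word X c n w = word (upd X b one2) c n (fock b (X b) w).
Proof.
move=> bn cb cb1; elim: n w bn => [|n IH] w bn; first lia.
have [bn'|bn'] := eqVneq n.+1 b.
  rewrite /= bn' cb updE fock1.
  by apply: eq_word => // a an; rewrite upd_out //; lia.
have [nb|nb] := eqVneq n b.
  move: nb IH => -> IH.
  by rewrite /= (negPf cb1) upd_out ?IH //; lia.
rewrite /= upd_out //; case: ifP => _; rewrite IH; try lia; last by [].
by rewrite (fock_comm b) //; lia.
Qed.

Lemma word_first {F : fieldType} (X : nat -> mat2 F) (c : nat -> bool) n b w : (1 <= b <= n)%N ->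
  ~~ c b -> c b.+1 ->
  word X c n w = fock b (X b) (word (upd X b one2) c n w).
Proof.
move=> bn cb cb1; elim: n w bn => [|n IH] w bn; first lia.
have [bn'|bn'] := eqVneq n.+1 b.
  rewrite /= bn' (negPf cb) updE fock1; congr fock.
  by apply: eq_word => // a an; rewrite upd_out //; lia.
have [nb|nb] := eqVneq n b.
  move: nb IH => -> IH.
  by rewrite /= cb1 upd_out ?IH //; lia.
rewrite /= upd_out //; case: ifP => _; rewrite IH; try lia; first by [].
by rewrite (fock_comm b) //; lia.
Qed.

(** Only factors below level [m] can stand between those of levels [m] and [m.+1], and they commute
    with the latter; the exchange [E] then applies. *)
Lemma word_flip {F : fieldType} (X X' : nat -> mat2 F) (c c' : nat -> bool) n m w :
  (1 <= m < n)%N -> c m.+1 -> ~~ c' m.+1 ->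
  (forall b : nat, b != m.+1 -> c b = c' b) ->
  (forall b : nat, b != m -> b != m.+1 -> X b = X' b) ->
  (forall w, fock m (X m) (fock m.+1 (X m.+1) w) =
             fock m.+1 (X' m.+1) (fock m (X' m) w)) ->
  word X c n w = word X' c' n w.
Proof.
move=> mn cm c'm Ec EX E; elim: n w mn => [|n IH] w mn; first lia.
have [nm|nm] := eqVneq n m; last first.
  rewrite /= EX ?Ec; try lia.
  by case: ifP => _; rewrite IH //; lia.
rewrite nm /= cm (negPf c'm); case: m mn cm c'm Ec EX E {IH nm} => [|m] mn; first lia.
move=> cm c'm Ec EX E /=.
have EW w' : word X c m w' = word X' c' m w'.
  by apply: eq_word => b bm; [apply: EX | apply: Ec]; lia.
rewrite -Ec ?EW; last lia.
by case: ifP => _; [rewrite E (word_comm X') | rewrite -(word_comm X') // E].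
Qed.

(* A vertical path sweeping the slab from column [p] to column [q] crosses level
   [b.-1] before level [b] iff [c b]; the third parameter of the matrix is read on
   that path when it crosses level [b]. *)
Definition slab_mat {F : fieldType} (p q : nat -> F) (d c : nat -> bool)
    (b : nat) : mat2 F :=
  if d b then Mat2 (p b / q b) ((if c b then q b.-1 else p b.-1) / q b) 0 1
  else Mat2 1 0 ((if c b.+1 then p b.+1 else q b.+1) / q b) (p b / q b).

Definition slab {F : fieldType} (r : nat) (p q : nat -> F) (d c : nat -> bool) :=
  word (slab_mat p q d c) c r.

(* The two bits correspond to the two diagonals of a square of the surface whose
   horizontal sides have opposite slopes. *)
Lemma slab_flip {F : fieldType} r (p q : nat -> F) (d c c' : nat -> bool) m w :
  (forall b, (1 <= b <= r)%N -> q b != 0) ->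
  (1 <= m < r)%N -> d m != d m.+1 -> c m.+1 -> ~~ c' m.+1 ->
  (forall b : nat, b != m.+1 -> c b = c' b) ->
  slab r p q d c w = slab r p q d c' w.
Proof.
move=> q0 mr dm cm c'm Ec; apply: (word_flip _ _ _ _ _ m) => //.
  by move=> b bm bm1; rewrite /slab_mat !Ec //; lia.
move=> {}w; rewrite /slab_mat cm (negPf c'm) /=.
case: (d m) dm; case: (d m.+1) => // _; last by rewrite fock_down_up ?q0 //; lia.
by rewrite Ec ?fock_up_down; try lia; rewrite (Ec m.+2) //; lia.
Qed.

(** Where the slopes at two adjacent levels differ, [slab_flip] lets the bit be chosen freely. This
    provides the orders needed for a mutation. *)
Lemma slab_order {F : fieldType} r (p q : nat -> F) (d c c' : nat -> bool) w :
  (forall b, (1 <= b <= r)%N -> q b != 0) ->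
  p 0%N = q 0%N -> p r.+1 = q r.+1 ->
  (forall b, (1 <= b < r)%N -> d b = d b.+1 -> c b.+1 = c' b.+1) ->
  slab r p q d c w = slab r p q d c' w.
Proof.
move=> q0 pq0 pqr Ec.
(* [h m] takes the bits below [m] from [c'] and the others from [c], so that the bits change one at
   a time. *)
pose h m b := if (b < m)%N then c' b else c b.
have E0 : slab r p q d c w = slab r p q d (h 0%N) w by [].
have hr b : (b < r.+2)%N -> h r.+2 b = c' b by rewrite /h => ->.
have Er : slab r p q d (h r.+2) w = slab r p q d c' w.
  rewrite /slab; apply: eq_word => b br; last by rewrite hr //; lia.
  by rewrite /slab_mat !hr //; lia.
rewrite E0 -Er; elim: r.+2 (leqnn r.+2) => // m IH mr.
rewrite IH; last lia.
have Eh b : b != m -> h m b = h m.+1 b.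
  by move=> bm; rewrite /h (_ : (b < m.+1)%N = (b < m)%N) //; lia.
have [hm|hm] := eqVneq (h m m) (h m.+1 m).
  congr (slab _ _ _ _ _ _); apply: functional_extensionality => b.
  by have [->//|bm] := eqVneq b m; apply: Eh.
have hmE : h m m = c m by rewrite /h ltnn.
have hm1E : h m.+1 m = c' m by rewrite /h ltnSn.
(* Bits outside 2..r order no factors. They at most select between the values of [p] and [q] at
   level 0 or [r.+1], which coincide. *)
have [m2|m2] := boolP (2 <= m <= r)%N; last first.
  rewrite /slab; apply: eq_word => b br; last by apply: Eh; lia.
  rewrite /slab_mat; congr (if _ then Mat2 _ (_ / _) _ _ else Mat2 _ _ (_ / _) _).
    have [bm|bm] := eqVneq b m; last by rewrite Eh.
    by rewrite (_ : b = 1%N) ?pq0 ?if_same //; lia.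
  have [bm|bm] := eqVneq b.+1 m; last by rewrite Eh.
  by rewrite (_ : b = r) ?pqr ?if_same //; lia.
case: m mr hm Eh hmE hm1E m2 {IH} => // m mr hm Eh hmE hm1E m2.
have dm : d m != d m.+1.
  by apply: contraNneq hm => /Ec; rewrite hmE hm1E => -> //; lia.
have mr' : (1 <= m < r)%N by lia.
case: (boolP (h m.+1 m.+1)) => [h1|h1].
  apply: (slab_flip _ _ _ _ _ _ m) => //.
  by apply: contraNN hm => ->; rewrite h1.
apply/esym/(slab_flip _ _ _ _ _ _ m) => //.
  by apply: contraNT hm => /negPf ->; rewrite (negPf h1).
by move=> b bm; rewrite Eh.
Qed.

Lemma eq_slab {F : fieldType} r (p q p' q' : nat -> F) (d d' c : nat -> bool) w :
  (forall b, p b = p' b) -> (forall b, q b = q' b) ->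
  (forall b, (1 <= b <= r)%N -> d b = d' b) ->
  slab r p q d c w = slab r p' q' d' c w.
Proof.
move=> Ep Eq Ed; rewrite /slab; apply: eq_word => // b br.
by rewrite /slab_mat !Ep !Eq Ed.
Qed.

(** * Surfaces and mutations *)

(* The quantified columns of the definitions carry a ring type instead of [int];
   restating them at [int] makes their terms syntactically equal to ours. *)
Lemma stepped_surfaceE r (k : nat -> int -> int) :
  stepped_surface r k =
  [/\ forall (a : nat) (j : int), (1 <= a <= r)%N -> even_idx a j (k a j),
      forall (a : nat) (j : int), (1 <= a < r)%N ->
        k a.+1 j - k a j = 1 \/ k a.+1 j - k a j = -1 &
      forall (a : nat) (j : int), (1 <= a <= r)%N ->
        k a (j + 1) - k a j = 1 \/ k a (j + 1) - k a j = -1].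
Proof. by []. Qed.

Lemma TsystemP {F : fieldType} r (T : nat -> int -> int -> F) :
  Tsystem r T ->
  [/\ forall (a : nat) (j k : int), (1 <= a <= r)%N -> ~~ even_idx a j k ->
        T a j (k + 1) * T a j (k - 1) =
        T a (j + 1) k * T a (j - 1) k + T a.+1 j k * T a.-1 j k,
      forall j k : int, even_idx 0 j k -> T 0%N j k = 1 &
      forall j k : int, even_idx r.+1 j k -> T r.+1 j k = 1].
Proof. by []. Qed.

Definition heights := nat -> int -> int.

Definition nonvanishing {F : fieldType} (r : nat) (T : nat -> int -> int -> F) :=
  forall b i l, (1 <= b <= r)%N -> even_idx b i l -> T b i l != 0.

(** A stepped surface prescribes no heights at levels 0 and [r.+1], so the boundary value 1 is
    inserted there directly. *)
Definition datum {F : fieldType} (r : nat) (T : nat -> int -> int -> F)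
    (k : heights) (i : int) (b : nat) : F :=
  if (1 <= b <= r)%N then T b i (k b i) else 1.

Definition upward (k : heights) (i : int) (b : nat) : bool :=
  k b i < k b (i + 1).

(* Only meaningful when levels [b.-1] and [b] have the same slope: then it selects
   the diagonal of the square whose ends have equal heights.  By [slab_order] its
   value is irrelevant otherwise. *)
Definition order_bit (k : heights) (i : int) (b : nat) : bool :=
  upward k i b.-1 == (k b.-1 i < k b i).

Definition strip {F : fieldType} r (T : nat -> int -> int -> F) (k : heights)
    (i : int) : (config -> F) -> config -> F :=
  slab r (datum r T k i) (datum r T k (i + 1)) (upward k i) (order_bit k i).

Lemma datum_neq0 {F : fieldType} r (T : nat -> int -> int -> F) (k : heights) (i : int) b :
  stepped_surface r k -> nonvanishing r T -> datum r T k i b != 0.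
Proof.
move=> [ev _ _] nz; rewrite /datum; case: ifP => br; last exact: oner_neq0.
by apply: nz => //; apply: ev.
Qed.

Lemma strip_order {F : fieldType} r (T : nat -> int -> int -> F) (k : heights) (i : int) c w :
  stepped_surface r k -> nonvanishing r T ->
  (forall b, (1 <= b < r)%N -> upward k i b = upward k i b.+1 ->
     c b.+1 = order_bit k i b.+1) ->
  strip r T k i w = slab r (datum r T k i) (datum r T k (i + 1)) (upward k i) c w.
Proof.
move=> sk nz Ec; apply: slab_order.
- by move=> b _; apply: datum_neq0.
- by [].
- by rewrite /datum ltnn andbF.
- by move=> b br /Ec ->.
Qed.

Lemma eq_strip {F : fieldType} r (T : nat -> int -> int -> F) (k k' : heights) (i : int) w :
  stepped_surface r k -> nonvanishing r T ->
  (forall b, (1 <= b <= r)%N -> k b i = k' b i /\ k b (i + 1) = k' b (i + 1)) ->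
  strip r T k i w = strip r T k' i w.
Proof.
move=> sk nz E; rewrite (strip_order _ _ _ _ (order_bit k' i)) //.
  apply: eq_slab => b; rewrite /datum; try by case: ifP => // /E[e1 e2]; rewrite ?e1 ?e2.
  by move=> /E[e1 e2]; rewrite /upward e1 e2.
move=> b br _; rewrite /order_bit /upward /=.
have [|-> ->] := E b; first lia.
by have [|-> _] := E b.+1; first lia.
Qed.

Definition raise (k : heights) (b : nat) (i : int) : heights :=
  fun a j => if (a == b) && (j == i) then k a j + 2 else k a j.

Definition local_min (r : nat) (k : heights) (b : nat) (i : int) : Prop :=
  [/\ k b (i - 1) = k b i + 1, k b (i + 1) = k b i + 1,
      (1 < b)%N -> k b.-1 i = k b i + 1 &
      (b < r)%N -> k b.+1 i = k b i + 1].

Lemma raise_stepped r (k : heights) (b : nat) (i : int) : (1 <= b <= r)%N ->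
  stepped_surface r k -> local_min r k b i -> stepped_surface r (raise k b i).
Proof.
move=> br; rewrite !stepped_surfaceE.
move=> [ev st1 st2] [mL mR mD mU]; split=> a j ar.
- have := ev a j ar; rewrite /raise; case: ifP => // _.
  by rewrite /even_idx; lia.
- have := st1 a j ar; rewrite /raise.
  case: (eqVneq a b) => [?|ab]; case: (eqVneq j i) => [?|ji];
    case: (eqVneq a.+1 b) => [?|ab1] //=; subst; try lia.
  by move: mD; rewrite /=; lia.
- have := st2 a j ar; rewrite /raise.
  case: (eqVneq a b) => [?|ab] //=.
  case: (eqVneq j i) => [?|ji]; case: (eqVneq (j + 1) i) => [?|ji1] //=; subst;
    try lia.
  by move: mL; rewrite addrK; lia.
Qed.

(** Once both slabs are suitably reordered, their factors at level [b] meet and [fock_mutation]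
    exchanges them, its hypothesis being one T-system relation. *)
Lemma strip_mutation {F : fieldType} r (T : nat -> int -> int -> F) (k : heights) (b : nat) (i : int) w :
  (1 <= b <= r)%N -> stepped_surface r k -> Tsystem r T -> nonvanishing r T ->
  local_min r k b (i + 1) ->
  strip r T k i (strip r T k (i + 1) w) =
  strip r T (raise k b (i + 1)) i (strip r T (raise k b (i + 1)) (i + 1) w).
Proof.
move=> br sk Tsys nz lm; set k' := raise k b (i + 1).
have sk' : stepped_surface r k' by apply: raise_stepped.
have := sk; rewrite stepped_surfaceE => -[ev st1 st2].
have k'E : k' b (i + 1) = k b (i + 1) + 2 by rewrite /k' /raise !eqxx.
have k'a (a : nat) (j : int) : a != b -> k' a j = k a j by rewrite /k' /raise => /negPf->.
have k'j (a : nat) (j : int) : j != i + 1 -> k' a j = k a j.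
  by rewrite /k' /raise => /negPf->; rewrite andbF.
have k'L a : k' a i = k a i by apply: k'j; lia.
have k'R a : k' a (i + 1 + 1) = k a (i + 1 + 1) by apply: k'j; lia.
case: lm; rewrite addrK => mL mR mD mU.
(* Orders for which the factor at level b comes last in the left slab and first
   in the right one, so that the two are adjacent; moreover no other factor then
   involves the value being mutated. *)
pose cL := upd (upd (order_bit k i) b true) b.+1 false.
pose cR := upd (upd (order_bit k (i + 1)) b false) b.+1 true.
have cLb : cL b by rewrite /cL upd_out ?updE //; lia.
have cLb1 : ~~ cL b.+1 by rewrite /cL updE.
have cRb : ~~ cR b by rewrite /cR upd_out ?updE //; lia.
have cRb1 : cR b.+1 by rewrite /cR updE.
have mD' a : a.+1 = b -> (1 <= a)%N -> k a (i + 1) = k b (i + 1) + 1.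
  by move=> ab a0; rewrite -mD -ab.
have stL a : (1 <= a <= r)%N -> k a (i + 1) - k a i = 1 \/ k a (i + 1) - k a i = -1.
  exact: st2.
have stR a : (1 <= a <= r)%N ->
    k a (i + 1 + 1) - k a (i + 1) = 1 \/ k a (i + 1 + 1) - k a (i + 1) = -1.
  exact: st2.
(* Where adjacent levels share a slope the bit is forced. The local minimum at level [b], and the
   local maximum after raising, force exactly the bits chosen in [cL] and [cR]. *)
have ELv a : (1 <= a < r)%N -> upward k i a = upward k i a.+1 ->
    cL a.+1 = order_bit k i a.+1.
  rewrite /order_bit /upward /= => /andP[a0 ar].
  move: (stL a) (stL a.+1); rewrite a0 ar (ltnW ar) => /(_ isT) sa /(_ isT) sa1.
  have [/eqP ab|ab] := boolP (a == b).
    move: (mU); rewrite -ab => /(_ ar) mU'; rewrite ab (negPf cLb1) /=.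
    by rewrite -ab in mL *; clear -mL mU' sa sa1; lia.
  have [/eqP ab1|ab1] := boolP (a.+1 == b); last by rewrite /cL !upd_out.
  have {}mD := mD' _ ab1 a0; rewrite ab1 cLb /=.
  by rewrite ab1 in sa1; clear -mL mD sa sa1; lia.
have ELv' a : (1 <= a < r)%N -> upward k' i a = upward k' i a.+1 ->
    cL a.+1 = order_bit k' i a.+1.
  rewrite /order_bit /upward /= !k'L => /andP[a0 ar].
  move: (stL a) (stL a.+1); rewrite a0 ar (ltnW ar) => /(_ isT) sa /(_ isT) sa1.
  have [/eqP ab|ab] := boolP (a == b).
    move: (mU); rewrite -ab => /(_ ar) mU'; rewrite ab (negPf cLb1) /= k'E k'a; last lia.
    by rewrite -ab in mL *; clear -mL mU' sa sa1; lia.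
  have [/eqP ab1|ab1] := boolP (a.+1 == b).
    have {}mD := mD' _ ab1 a0; rewrite ab1 cLb /= k'E k'a //.
    by rewrite ab1 in sa1; clear -mL mD sa sa1; lia.
  by rewrite /cL !upd_out // /order_bit /upward /= !k'a.
have ERv a : (1 <= a < r)%N -> upward k (i + 1) a = upward k (i + 1) a.+1 ->
    cR a.+1 = order_bit k (i + 1) a.+1.
  rewrite /order_bit /upward /= => /andP[a0 ar].
  move: (stR a) (stR a.+1); rewrite a0 ar (ltnW ar) => /(_ isT) sa /(_ isT) sa1.
  have [/eqP ab|ab] := boolP (a == b).
    move: (mU); rewrite -ab => /(_ ar) mU'; rewrite ab cRb1 /=.
    by rewrite -ab in mR *; clear -mR mU' sa sa1; lia.
  have [/eqP ab1|ab1] := boolP (a.+1 == b); last by rewrite /cR !upd_out.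
  have {}mD := mD' _ ab1 a0; rewrite ab1 (negPf cRb) /=.
  by rewrite ab1 in sa1; clear -mR mD sa sa1; lia.
have ERv' a : (1 <= a < r)%N -> upward k' (i + 1) a = upward k' (i + 1) a.+1 ->
    cR a.+1 = order_bit k' (i + 1) a.+1.
  rewrite /order_bit /upward /= !k'R => /andP[a0 ar].
  move: (stR a) (stR a.+1); rewrite a0 ar (ltnW ar) => /(_ isT) sa /(_ isT) sa1.
  have [/eqP ab|ab] := boolP (a == b).
    move: (mU); rewrite -ab => /(_ ar) mU'; rewrite ab cRb1 /= k'E k'a; last lia.
    by rewrite -ab in mR *; clear -mR mU' sa sa1; lia.
  have [/eqP ab1|ab1] := boolP (a.+1 == b).
    have {}mD := mD' _ ab1 a0; rewrite ab1 (negPf cRb) /= k'E k'a //.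
    by rewrite ab1 in sa1; clear -mR mD sa sa1; lia.
  by rewrite /cR !upd_out // /order_bit /upward /= !k'a.
rewrite (strip_order r T k i cL _ sk nz ELv).
rewrite (strip_order r T k (i + 1) cR _ sk nz ERv).
rewrite (strip_order r T k' i cL _ sk' nz ELv').
rewrite (strip_order r T k' (i + 1) cR _ sk' nz ERv').
have colL : datum r T k' i = datum r T k i.
  by apply: functional_extensionality => a; rewrite /datum k'L.
have colR : datum r T k' (i + 1 + 1) = datum r T k (i + 1 + 1).
  by apply: functional_extensionality => a; rewrite /datum k'R.
have colM a : a != b -> datum r T k' (i + 1) a = datum r T k (i + 1) a.
  by move=> ab; rewrite /datum k'a.
clear ELv ELv' ERv ERv' stL stR.
rewrite colL colR /slab.
set XL := slab_mat _ _ (upward k i) _; set XR := slab_mat _ _ (upward k (i + 1)) _.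
set YL := slab_mat _ _ (upward k' i) _; set YR := slab_mat _ _ (upward k' (i + 1)) _.
rewrite (word_last XL cL r b _ br cLb cLb1) (word_last YL cL r b _ br cLb cLb1).
rewrite (word_first XR cR r b _ br cRb cRb1) (word_first YR cR r b _ br cRb cRb1).
have eL v : word (upd XL b one2) cL r v = word (upd YL b one2) cL r v.
  apply: eq_word => // a ar; have [->|ab] := eqVneq a b; first by rewrite !updE.
  rewrite !upd_out // /XL /YL /slab_mat /upward k'L k'a // colM //.
  have [ab1|ab1] := eqVneq a b.+1.
    by rewrite ab1 (negPf cLb1) colM //; lia.
  rewrite (colM a.-1); last lia.
  have [ab2|ab2] := eqVneq a.+1 b; first by rewrite ab2 cLb.
  by rewrite (colM a.+1).
have eR v : word (upd XR b one2) cR r v = word (upd YR b one2) cR r v.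
  apply: eq_word => // a ar; have [->|ab] := eqVneq a b; first by rewrite !updE.
  rewrite !upd_out // /XR /YR /slab_mat /upward k'R k'a // colM //.
  have [ab1|ab1] := eqVneq a b.+1.
    by rewrite ab1 cRb1 colM //; lia.
  rewrite (colM a.-1); last lia.
  have [ab2|ab2] := eqVneq a.+1 b; first by rewrite ab2 (negPf cRb).
  by rewrite (colM a.+1).
rewrite eL eR; congr (word _ _ _ _).
rewrite /XL /YL /XR /YR /slab_mat (negPf cLb1) cLb (negPf cRb) cRb1.
have -> : upward k i b = false by rewrite /upward mL; clear; lia.
have -> : upward k' i b = true by rewrite /upward k'E k'L mL; clear; lia.
have -> : upward k (i + 1) b = true by rewrite /upward mR; clear; lia.
have -> : upward k' (i + 1) b = false.
  by rewrite /upward k'E k'R mR; clear; lia.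
rewrite (colM b.+1); last lia.
rewrite (colM b.-1); last lia.
apply: fock_mutation; try exact: datum_neq0.
have [Trec T0 Tr] := TsystemP _ _ Tsys.
(* The relation is centred halfway between the old and the new height, where the neighbours of the
   mutated vertex lie. *)
set h := k b (i + 1) + 1.
have eh : even_idx b (i + 1) (h - 1) by rewrite /h addrK; apply: ev.
have colU : datum r T k (i + 1) b.+1 = T b.+1 (i + 1) h.
  rewrite /datum; case: ifP => br1; first by rewrite mU //; lia.
  have -> : b = r by lia.
  rewrite Tr //; move: eh; rewrite (_ : b = r); last lia.
  by rewrite /even_idx; clear; lia.
have colD : datum r T k (i + 1) b.-1 = T b.-1 (i + 1) h.
  rewrite /datum; case: ifP => br1; first by rewrite mD //; lia.
  have b1 : b = 1%N by lia.
  rewrite b1 /= T0 //; move: eh; rewrite b1.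
  by rewrite /even_idx; clear; lia.
rewrite colU colD /datum br k'E mR mL -/h.
have := Trec b (i + 1) h br.
rewrite (_ : h - 1 = k b (i + 1)); last by rewrite /h addrK.
rewrite (_ : i + 1 - 1 = i); last by rewrite addrK.
rewrite (_ : h + 1 = k b (i + 1) + 2); last by rewrite /h -addrA.
move=> -> //; move: eh; rewrite /even_idx; clear; lia.
Qed.

Fixpoint strips {F : fieldType} r (T : nat -> int -> int -> F) (k : heights)
    (L : int) (N : nat) (w : config -> F) : config -> F :=
  if N is M.+1 then strip r T k L (strips r T k (L + 1) M w) else w.

Lemma eq_strips {F : fieldType} r (T : nat -> int -> int -> F) (k k' : heights)
    (L : int) N w :
  stepped_surface r k -> nonvanishing r T ->
  (forall (b : nat) (i : int), (1 <= b <= r)%N -> L <= i <= L + N%:Z ->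
     k b i = k' b i) ->
  strips r T k L N w = strips r T k' L N w.
Proof.
move=> sk nz; elim: N L => //= N IH L E.
rewrite IH; last by move=> b i br iL; apply: E; lia.
by apply: eq_strip => // b br; split; apply: E; lia.
Qed.

Lemma strips_mutation {F : fieldType} r (T : nat -> int -> int -> F)
    (k : heights) (b : nat) (L i : int) N w :
  (1 <= b <= r)%N -> stepped_surface r k -> Tsystem r T -> nonvanishing r T ->
  local_min r k b i -> L < i < L + N%:Z ->
  strips r T k L N w = strips r T (raise k b i) L N w.
Proof.
move=> br sk Tsys nz lm; elim: N L => [|N IH] L iL; first lia.
have raiseE (a : nat) (j : int) : j != i -> k a j = raise k b i a j.
  by move=> ji; rewrite /raise (negPf ji) andbF.
have [iL1|iL1] := eqVneq i (L + 1).
  case: N iL {IH} => [|N] iL /=; first lia.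
  rewrite iL1 in lm raiseE *; rewrite (strip_mutation _ _ _ b) //; congr (strip _ _ _ _ (strip _ _ _ _ _)).
  by apply: eq_strips => // a j _ jL; apply: raiseE; lia.
rewrite /= IH; last lia.
by apply: eq_strip => // a _; split; apply: raiseE; lia.
Qed.

(** Flatness: [k] is raised to [k'] by mutations strictly between the end columns, each preserving
    the product. The induction is on the total gap [mu]. *)
Lemma strips_flat {F : fieldType} r (T : nat -> int -> int -> F)
    (k k' : heights) (L : int) N w :
  Tsystem r T -> nonvanishing r T ->
  stepped_surface r k -> stepped_surface r k' ->
  (forall (b : nat) (i : int), (1 <= b <= r)%N -> k b i <= k' b i) ->
  (forall b : nat, (1 <= b <= r)%N ->
     k b L = k' b L /\ k b (L + N%:Z) = k' b (L + N%:Z)) ->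
  strips r T k L N w = strips r T k' L N w.
Proof.
move=> Tsys nz + sk'.
pose h (k : heights) (x : 'I_r * 'I_N.+1) := k x.1.+1 (L + x.2%:Z).
pose mu k := (\sum_x `|h k' x - h k x|)%N.
move: {2}(mu k).+1 (ltnSn (mu k)) => n; elim: n k => // n IH k kn sk kk' bd.
case: (pickP (fun x => h k x < h k' x)) => [x0 Px0|eqk]; last first.
  apply: eq_strips => // b i br iL.
  have b' : (b.-1 < r)%N by lia.
  have i' : (`|(i - L)%R|%N < N.+1)%N by lia.
  have := eqk (Ordinal b', Ordinal i'); rewrite /h /=.
  have -> : b.-1.+1 = b by lia.
  have -> : L + `|(i - L)%R|%N%:Z = i by lia.
  by have := kk' b i br; lia.
(* A lowest point among those where [k < k'] is a local minimum of [k]. *)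
case: (@arg_minP _ _ _ x0 (fun x => h k x < h k' x) (h k) Px0) => x Px minx.
set b := x.1.+1; set i := L + x.2%:Z.
have br : (1 <= b <= r)%N by rewrite /b ltn_ord.
rewrite stepped_surfaceE in sk'; have [ev' st1' st2'] := sk'.
have := sk; rewrite stepped_surfaceE => -[ev st1 st2].
have kx : k b i < k' b i by [].
(* Both heights have the same parity, so a strict inequality leaves room for a raise by 2. *)
have kx2 : k b i + 2 <= k' b i.
  move: (ev b i br) (ev' b i br); rewrite /even_idx; clear -kx; lia.
(* A neighbour at [k b i - 1] would also lie below [k'], which is at least [k b i + 1] there; this
   contradicts the minimality of [x]. *)
have near (c : nat) (j : int) : (1 <= c <= r)%N -> L <= j <= L + N%:Z ->
    (k c j = k b i + 1 \/ k c j = k b i - 1) ->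
    (k' b i - k' c j = 1 \/ k' b i - k' c j = -1) -> k c j = k b i + 1.
  move=> cr jL [//|kc] kc'.
  have c' : (c.-1 < r)%N by lia.
  have j' : (`|(j - L)%R|%N < N.+1)%N by lia.
  have := minx (Ordinal c', Ordinal j'); rewrite /h /=.
  have -> : c.-1.+1 = c by lia.
  have -> : L + `|(j - L)%R|%N%:Z = j by lia.
  rewrite -/b -/i; have := kk' c j cr; clear -kc kc' kx2; lia.
have iN : L <= i <= L + N%:Z by rewrite /i; have := ltn_ord x.2; lia.
have iL : i != L by apply: contraTneq kx => ->; rewrite -(bd b br).1 ltxx.
have iR : i != L + N%:Z by apply: contraTneq kx => ->; rewrite -(bd b br).2 ltxx.
have lm : local_min r k b i.
  split=> [||b1|b1].
  - apply: near; [by []|lia| |].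
      by move: (st2 b (i - 1) br); rewrite subrK; clear; lia.
    by move: (st2' b (i - 1) br); rewrite subrK; clear; lia.
  - apply: near; [by []|lia| |].
      by move: (st2 b i br); clear; lia.
    by move: (st2' b i br); clear; lia.
  - have br' : (1 <= b.-1 < r)%N by lia.
    apply: near; [lia|lia| |].
      by move: (st1 b.-1 i br'); rewrite (ltn_predK b1); clear; lia.
    by move: (st1' b.-1 i br'); rewrite (ltn_predK b1); clear; lia.
  - have br' : (1 <= b < r)%N by lia.
    apply: near; [lia|lia| |].
      by move: (st1 b i br'); clear; lia.
    by move: (st1' b i br'); clear; lia.
rewrite (strips_mutation _ _ _ b L i) //; last by clear -iN iL iR; lia.
have raiseE (a : nat) (j : int) : j != i -> raise k b i a j = k a j.
  by move=> ji; rewrite /raise (negPf ji) andbF.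
apply: IH.
- apply: (@leq_trans (mu k)) => //; rewrite /mu.
  rewrite (bigD1 x) // [X in (_ < X)%N](bigD1 x) //= -addSn leq_add //.
    by rewrite /h /raise -/b -/i !eqxx /=; clear -kx2; lia.
  apply: leq_sum => y _; rewrite /h /raise; case: ifP => // /andP[/eqP-> /eqP->].
  by clear -kx2; lia.
- exact: raise_stepped.
- move=> c j cr; rewrite /raise; case: ifP => [/andP[/eqP-> /eqP->] //|_].
  exact: kk'.
- by move=> c cr; rewrite !raiseE 1?eq_sym //; apply: bd.
Qed.

(** * The minor attached to a point above the surface *)

(** Among the sites 1..r+1 these are the rows and columns of the minor. *)
Definition ground (a : nat) : config := fun n => (a < n)%N.

(* Sites beyond [r.+1] are never moved and are ignored. *)
Definition agree (r a : nat) (S : config) : bool :=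
  [forall n : 'I_r.+2, S n == ground a n].

Definition ground_vec {F : fieldType} (r a : nat) : config -> F :=
  fun S => (agree r a S)%:R.

Lemma ground_vec_ground {F : fieldType} r a : ground_vec r a (ground a) = 1 :> F.
Proof. by rewrite /ground_vec (_ : agree _ _ _) //; apply/forallP. Qed.

Lemma agreeP r a S n : agree r a S -> (n <= r.+1)%N -> S n = (a < n)%N.
Proof. by move=> /forallP E nr; apply/eqP/(E (Ordinal (nr : (n < r.+2)%N))). Qed.

Definition weight {F : fieldType} (a : nat) (p q : nat -> F) (b : nat) : F :=
  if (a <= b)%N then p b / q b else 1.

(** Above level [a] both sites are occupied and the determinant [p b / q b] acts; below [a] both are
    empty. At level [a] a downward matrix is lower triangular, so it only scales the vector, by
    [p a / q a]. *)
Lemma fock_ground_vec {F : fieldType} r a (p q : nat -> F) (d c : nat -> bool) b :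
  (1 <= b <= r)%N -> (b = a -> ~~ d b) ->
  fock b (slab_mat p q d c b) (ground_vec r a) =
  (fun S => weight a p q b * ground_vec r a S).
Proof.
move=> br da; apply: functional_extensionality => S.
have sw : agree r a (swap b S) -> S b.+1 = (a < b)%N /\ S b = (a <= b)%N.
  by move=> ag; rewrite -(swapL b S) -(swapR b S) !(agreeP _ _ _ _ ag) //; lia.
have w0 : ~~ S b -> S b.+1 -> ground_vec r a (swap b S) = 0 :> F.
  rewrite /ground_vec; case: (boolP (agree _ _ _)) => // /sw[-> ->]; lia.
have w1 : S b -> ~~ S b.+1 -> d b -> ground_vec r a (swap b S) = 0 :> F.
  rewrite /ground_vec; case: (boolP (agree _ _ _)) => // /sw[-> ->] h1 h2.
  by rewrite (negPf (da _)) //; lia.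
have w2 : agree r a S -> S b.+1 = (a <= b)%N /\ S b = (a < b)%N.
  by move=> ag; rewrite !(agreeP _ _ _ _ ag) //; lia.
rewrite /fock /slab_mat /weight; move: w0 w1 w2.
case: (S b) => /=; case: (S b.+1) => /=.
- move=> _ _; rewrite {1 2}/ground_vec; case: (boolP (agree _ _ _)) => [_ /(_ isT)[<- _]|].
    by case: (d b) => /=; ring.
  by rewrite !mulr0.
- move=> _ w1; rewrite {1 3}/ground_vec; case: (boolP (agree _ _ _)) => [_ /(_ isT)[ab1 ab]|].
    by lia.
  by rewrite !mulr0; case: (d b) w1 => /= [->|]; rewrite ?mulr0 ?mul0r ?addr0.
- move=> -> // _; rewrite /ground_vec; case: (boolP (agree _ _ _)) => [_ /(_ isT)[ab1 ab]|].
    have ba : b = a by lia.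
    by rewrite -ab1 (negPf (da ba)) /= mulr0 add0r.
  by rewrite !mulr0 addr0.
- move=> _ _; rewrite /ground_vec; case: (boolP (agree _ _ _)) => [_ /(_ isT)[<- _]|].
    by rewrite mul1r.
  by rewrite mulr0.
Qed.

(** The dual statement for a row: at level [a] an upward matrix has bottom row (0, 1), so that level
    contributes 1 and the weight starts at [a.+1]. *)
Lemma fock_ground {F : fieldType} a (p q : nat -> F) (d c : nat -> bool) b w :
  (b = a -> d b) ->
  fock b (slab_mat p q d c b) w (ground a) = weight a.+1 p q b * w (ground a).
Proof.
move=> da; rewrite /fock /slab_mat /weight /ground ltnS.
have [ab|ab|ab] := ltngtP a b; last first.
- by rewrite -ab in da *; rewrite da //= mul0r add0r.
- by rewrite mul1r; case: (leqP a b) => //; lia.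
by case: (d b) => /=; rewrite ?(mulr1, mul1r, mulr0, mul0r, subr0).
Qed.

Lemma fockZ {F : fieldType} b (G : mat2 F) (s : F) w :
  fock b G (fun S => s * w S) = (fun S => s * fock b G w S).
Proof.
apply: functional_extensionality => S; rewrite /fock.
by case: (S b); case: (S b.+1); ring.
Qed.

Lemma wordZ {F : fieldType} (X : nat -> mat2 F) (c : nat -> bool) n (s : F) w :
  word X c n (fun S => s * w S) = (fun S => s * word X c n w S).
Proof. by elim: n w => //= n IH w; case: (c n.+1); rewrite ?IH fockZ ?IH. Qed.

Lemma word_eigenvector {F : fieldType} (X : nat -> mat2 F) (c : nat -> bool) n (s : nat -> F) w :
  (forall b, (1 <= b <= n)%N -> fock b (X b) w = (fun S => s b * w S)) ->
  word X c n w = (fun S => (\prod_(1 <= b < n.+1) s b) * w S).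
Proof.
elim: n => [|n IH] E /=.
  by rewrite big_geq //; apply: functional_extensionality => S; rewrite mul1r.
have {}IH : word X c n w = (fun S => (\prod_(1 <= b < n.+1) s b) * w S).
  by apply: IH => b bn; apply: E; lia.
have En := E n.+1 (leqnn _); case: (c n.+1); rewrite ?IH ?En ?fockZ ?wordZ ?IH ?En;
  apply: functional_extensionality => S;
  rewrite [in RHS]big_nat_recr //=; ring.
Qed.

Lemma word_eigencovector {F : fieldType} (X : nat -> mat2 F) (c : nat -> bool) n (s : nat -> F) v w :
  (forall b w, (1 <= b <= n)%N -> fock b (X b) w v = s b * w v) ->
  word X c n w v = (\prod_(1 <= b < n.+1) s b) * w v.
Proof.
elim: n w => [|n IH] w E /=; first by rewrite big_geq // mul1r.
have {}IH w' : word X c n w' v = (\prod_(1 <= b < n.+1) s b) * w' v.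
  by apply: IH => b ? bn; apply: E; lia.
by case: (c n.+1); rewrite ?IH E ?leqnn // ?IH [in RHS]big_nat_recr //=; ring.
Qed.

Definition datum_prod {F : fieldType} r (T : nat -> int -> int -> F)
    (k : heights) (a : nat) (i : int) : F :=
  \prod_(1 <= b < r.+1 | (a <= b)%N) datum r T k i b.

Lemma prod_weight {F : fieldType} r (T : nat -> int -> int -> F)
    (k : heights) (a : nat) (i j : int) :
  \prod_(1 <= b < r.+1) weight a (datum r T k i) (datum r T k j) b =
  datum_prod r T k a i / datum_prod r T k a j.
Proof. by rewrite /datum_prod -prodf_div [RHS]big_mkcond. Qed.

Lemma datum_prod_neq0 {F : fieldType} r (T : nat -> int -> int -> F)
    (k : heights) (a : nat) (i : int) :
  stepped_surface r k -> nonvanishing r T -> datum_prod r T k a i != 0.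
Proof.
move=> sk nz; rewrite /datum_prod; elim/big_rec: _ => [|b x _ x0].
  exact: oner_neq0.
by rewrite mulf_neq0 // datum_neq0.
Qed.

(** Each slab contributes the quotient of the products over its two columns, and these quotients
    telescope. *)
Lemma strips_ground {F : fieldType} r (T : nat -> int -> int -> F)
    (k : heights) (a : nat) (L : int) N w :
  stepped_surface r k -> nonvanishing r T ->
  (forall i : int, L <= i < L + N%:Z -> upward k i a) ->
  strips r T k L N w (ground a) =
  datum_prod r T k a.+1 L / datum_prod r T k a.+1 (L + N%:Z) * w (ground a).
Proof.
move=> sk nz; elim: N L => [|N IH] L up /=.
  by rewrite addr0 divff ?mul1r ?datum_prod_neq0.
rewrite /strip /slab (word_eigencovector _ _ _ (weight a.+1 (datum r T k L) (datum r T k (L + 1)))).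
  rewrite prod_weight IH; last by move=> i iL; apply: up; lia.
  rewrite -addrA -intS mulrA mulrA divfK ?datum_prod_neq0 //.
by move=> b w' br; apply: fock_ground => ->; apply: up; lia.
Qed.

Lemma strips_ground_vec {F : fieldType} r (T : nat -> int -> int -> F)
    (k : heights) (a : nat) (L : int) N :
  stepped_surface r k -> nonvanishing r T ->
  (forall i : int, L <= i < L + N%:Z -> ~~ upward k i a) ->
  strips r T k L N (ground_vec r a) =
  (fun S => datum_prod r T k a L / datum_prod r T k a (L + N%:Z) * ground_vec r a S).
Proof.
move=> sk nz; elim: N L => [|N IH] L down /=.
  apply: functional_extensionality => S.
  by rewrite addr0 divff ?mul1r ?datum_prod_neq0.
rewrite IH; last by move=> i iL; apply: down; lia.
rewrite /strip /slab wordZ.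
rewrite (word_eigenvector _ _ _ (weight a (datum r T k L) (datum r T k (L + 1)))).
  apply: functional_extensionality => S.
  rewrite prod_weight -addrA -intS mulrA; congr (_ * _).
  by rewrite mulrC mulrA divfK ?datum_prod_neq0.
by move=> b br; apply: fock_ground_vec => // ->; apply: down; lia.
Qed.

Lemma strips_cat {F : fieldType} r (T : nat -> int -> int -> F)
    (k : heights) (L : int) M N w :
  strips r T k L (M + N) w = strips r T k L M (strips r T k (L + M%:Z) N w).
Proof.
elim: M L => [|M IH] L /=; first by rewrite addr0.
by rewrite IH -addrA -intS.
Qed.

(** [s n + n] has the parity of [h] and grows by 0 or 2 at each step, so it cannot jump over [h];
    periodicity makes it unbounded. *)
Lemma first_crossing (s : nat -> int) (h : int) :
  s 0%N <= h -> (forall n, (2 %| s n + n%:Z - h)%Z) ->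
  (forall n, s n.+1 - s n = 1 \/ s n.+1 - s n = -1) ->
  (forall n, s (2 * n)%N = s 0%N) ->
  exists2 N, s N + N%:Z = h & forall n, (n <= N)%N -> s n + n%:Z <= h.
Proof.
move=> s0 par st per.
have ex : exists n, h <= s n + n%:Z.
  by exists (2 * `|(h - s 0%N)%R|)%N; rewrite per; lia.
case: (ex_minnP ex) => N hN minN.
have lt n : (n < N)%N -> s n + n%:Z < h.
  by move=> nN; rewrite ltNge; apply/negP => /minN; lia.
have EN : s N + N%:Z = h.
  case: N hN {minN} lt => [|N] hN lt; first lia.
  by have := lt N (ltnSn N); have := st N; have := par N; have := par N.+1; lia.
exists N => // n; rewrite leq_eqVlt => /orP[/eqP->|/lt/ltW //].
by rewrite EN.
Qed.

(** The maximum of [k] and the pyramid of slope one with apex [(a, j, h)]. *)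
Definition cone_over (k : heights) (a : nat) (j h : int) : heights :=
  fun b i => Num.max (k b i) (h - `|i - j| - `|b%:Z - a%:Z|).

Lemma cone_over_stepped r k (a : nat) (j h : int) : even_idx a j h ->
  stepped_surface r k -> stepped_surface r (cone_over k a j h).
Proof.
rewrite !stepped_surfaceE => eh [ev st1 st2]; split=> b i br.
- by move: (ev b i br) eh; rewrite /cone_over /even_idx; clear; lia.
- have br1 : (1 <= b.+1 <= r)%N by lia.
  have br0 : (1 <= b <= r)%N by lia.
  move: (ev b i br0) (ev b.+1 i br1) eh (st1 b i br).
  by rewrite /cone_over /even_idx; clear; lia.
- move: (ev b i br) (ev b (i + 1) br) eh (st2 b i br).
  by rewrite /cone_over /even_idx; clear; lia.
Qed.

(** On the raised surface the product splits at column [j] into an upward half and a downward half.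
    The two monomials leave at [j] the quotient of the products over levels from [a] and from
    [a.+1], which is [T a j h]. *)
Lemma cone_formula {F : fieldType} r (T : nat -> int -> int -> F)
    (k : heights) (a : nat) (j h : int) M N :
  (1 <= a <= r)%N -> even_idx a j h ->
  stepped_surface r k -> Tsystem r T -> nonvanishing r T ->
  k a (j - M%:Z) + M%:Z = h -> k a (j + N%:Z) + N%:Z = h ->
  (forall n, (n <= M)%N -> k a (j - n%:Z) + n%:Z <= h) ->
  (forall n, (n <= N)%N -> k a (j + n%:Z) + n%:Z <= h) ->
  T a j h = strips r T k (j - M%:Z) (M + N) (ground_vec r a) (ground a)
    / datum_prod r T k a.+1 (j - M%:Z) * datum_prod r T k a (j + N%:Z).
Proof.
move=> ar eh sk Tsys nz EM EN leM leN; set k' := cone_over k a j h.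
have sk' : stepped_surface r k' by apply: cone_over_stepped.
have := sk; rewrite stepped_surfaceE => -[_ st _].
(* The surface drops by at most one per level. In the end columns the pyramid touches [k] at level
   [a], so there it lies below [k] at every level. *)
have lip (b : nat) (i : int) : (1 <= b <= r)%N -> k a i - `|b%:Z - a%:Z| <= k b i.
  move=> br; have [ab|/ltnW ba] := leqP a b.
    elim: b ab br => [|b IH] ab br; first lia.
    have [/eqP <-|ab'] := boolP (a == b.+1); first by clear; lia.
    have {}IH := IH ltac:(lia) ltac:(lia).
    by have := st b i ltac:(lia); lia.
  elim: a ba ar {eh EM EN leM leN k' sk'} => [|a IH] ba ar; first lia.
  have [/eqP <-|ab'] := boolP (b == a.+1); first by clear; lia.
  have {}IH := IH ltac:(lia) ltac:(lia).
  by have := st a i ltac:(lia); lia.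
have endL (b : nat) : (1 <= b <= r)%N -> k' b (j - M%:Z) = k b (j - M%:Z).
  by move=> br; have := lip b (j - M%:Z) br; rewrite /k' /cone_over; clear -EM; lia.
have endR (b : nat) : (1 <= b <= r)%N -> k' b (j + N%:Z) = k b (j + N%:Z).
  by move=> br; have := lip b (j + N%:Z) br; rewrite /k' /cone_over; clear -EN; lia.
have slopeL (n : nat) : (n <= M)%N -> k' a (j - n%:Z) = h - n%:Z.
  by move=> /leM; rewrite /k' /cone_over; clear; lia.
have slopeR (n : nat) : (n <= N)%N -> k' a (j + n%:Z) = h - n%:Z.
  by move=> /leN; rewrite /k' /cone_over; clear; lia.
have prodE (b : nat) (i : int) :
    (forall c : nat, (1 <= c <= r)%N -> k' c i = k c i) ->
    datum_prod r T k' b i = datum_prod r T k b i.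
  move=> E; rewrite /datum_prod; apply: eq_bigr => c _.
  by rewrite /datum; case: ifP => // /E->.
rewrite (strips_flat r T k k') //; first last.
- move=> b br; split; first by rewrite endL.
  by rewrite (_ : j - M%:Z + (M + N)%N%:Z = j + N%:Z) ?endR //; lia.
- by move=> b i _; rewrite /k' /cone_over le_max lexx.
rewrite strips_cat strips_ground //; last first.
  move=> i iM; rewrite /upward.
  have := slopeL `|(j - i)%R|%N ltac:(lia).
  have := slopeL `|(j - (i + 1))%R|%N ltac:(lia).
  have -> : j - `|(j - i)%R|%N%:Z = i by lia.
  have -> : j - `|(j - (i + 1))%R|%N%:Z = i + 1 by lia.
  lia.
rewrite subrK strips_ground_vec //; last first.
  move=> i iN; rewrite /upward.
  have := slopeR `|(i - j)%R|%N ltac:(lia).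
  have := slopeR `|(i + 1 - j)%R|%N ltac:(lia).
  have -> : j + `|(i - j)%R|%N%:Z = i by lia.
  have -> : j + `|(i + 1 - j)%R|%N%:Z = i + 1 by lia.
  lia.
rewrite ground_vec_ground mulr1 (prodE _ _ endL) (prodE _ _ endR).
have -> : datum_prod r T k' a j = T a j h * datum_prod r T k' a.+1 j.
  rewrite /datum_prod big_mkcond (bigD1_seq a) ?iota_uniq //=; last first.
    by rewrite mem_index_iota; lia.
  rewrite leqnn /datum ar; have := slopeR 0%N isT.
  rewrite addr0 subr0 => ->; congr (_ * _).
  by rewrite -big_mkcondr /=; apply: eq_bigl => b; lia.
have := datum_prod_neq0 r T k' a.+1 j sk' nz.
have := datum_prod_neq0 r T k a.+1 (j - M%:Z) sk nz.
have := datum_prod_neq0 r T k a (j + N%:Z) sk nz.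
move: (datum_prod _ _ _ _ _) (datum_prod _ _ _ _ _) (datum_prod _ _ _ _ _).
by move=> x y z x0 y0 z0; field; rewrite x0 y0 z0.
Qed.

(** * Positivity *)

(** [f] is a family over all fields and solutions because a single [P], chosen first, must serve
    them all. *)
Definition positive_laurent r (k : heights)
    (f : forall F : fieldType, (nat -> int -> int -> F) -> F) : Prop :=
  exists P : laurent, lvars_in r P /\
    forall (F : fieldType) (T : nat -> int -> int -> F),
      Tsystem r T -> nonvanishing r T -> f F T = leval (fun b i => T b i (k b i)) P.

Lemma eq_positive r k f g :
  (forall (F : fieldType) (T : nat -> int -> int -> F),
     Tsystem r T -> nonvanishing r T -> f F T = g F T) ->
  positive_laurent r k g -> positive_laurent r k f.
Proof. by move=> E [P [vP EP]]; exists P; split=> // F T Ts nz; rewrite E ?EP. Qed.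

Lemma positive0 r k : positive_laurent r k (fun _ _ => 0).
Proof. by exists [::]; split=> // F T _ _; rewrite /leval big_nil. Qed.

Lemma positive1 r k : positive_laurent r k (fun _ _ => 1).
Proof.
exists [:: (1%N, [::])]; split=> // F T _ _.
by rewrite /leval big_seq1 big_nil mulr1.
Qed.

Lemma positiveD r k f g : positive_laurent r k f -> positive_laurent r k g ->
  positive_laurent r k (fun F T => f F T + g F T).
Proof.
move=> [P [vP EP]] [Q [vQ EQ]]; exists (P ++ Q); split.
  by rewrite /lvars_in all_cat; apply/andP.
by move=> F T Ts nz; rewrite EP ?EQ // /leval big_cat.
Qed.

Lemma positiveM r k f g : positive_laurent r k f -> positive_laurent r k g ->
  positive_laurent r k (fun F T => f F T * g F T).
Proof.
move=> [P [vP EP]] [Q [vQ EQ]].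
exists [seq (m.1 * m'.1, m.2 ++ m'.2)%N | m <- P, m' <- Q]; split.
  apply/allP => _ /allpairsP[[m m'] [mP mQ ->]] /=.
  by rewrite all_cat (allP vP _ mP) (allP vQ _ mQ).
move=> F T Ts nz; rewrite EP ?EQ // /leval big_allpairs_dep /= big_distrl /=.
apply: eq_bigr => m _; rewrite big_distrr /=; apply: eq_bigr => m' _.
by rewrite natrM big_cat mulrACA.
Qed.

Lemma positive_datum r k b i :
  positive_laurent r k (fun F T => datum r T k i b).
Proof.
rewrite /datum; case br: (1 <= b <= r)%N; last exact: positive1.
exists [:: (1%N, [:: (b, i, 1)])]; split; first by rewrite /lvars_in /= br.
by move=> F T _ _; rewrite /leval !big_seq1 mul1r expr1z.
Qed.

Lemma positive_datumV r k b i :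
  positive_laurent r k (fun F T => (datum r T k i b)^-1).
Proof.
rewrite /datum; case br: (1 <= b <= r)%N.
  exists [:: (1%N, [:: (b, i, -1)])]; split; first by rewrite /lvars_in /= br.
  by move=> F T _ _; rewrite /leval !big_seq1 mul1r exprN1.
by apply: eq_positive (positive1 r k) => F T _ _; rewrite invr1.
Qed.

Lemma positive_prod r k (I : Type) (s : seq I) (p : pred I) f :
  (forall x, positive_laurent r k (f x)) ->
  positive_laurent r k (fun F T => \prod_(x <- s | p x) f x F T).
Proof.
move=> fP; elim: s => [|x s IH].
  by apply: eq_positive (positive1 r k) => F T _ _; rewrite big_nil.
case px : (p x).
  by apply: eq_positive (positiveM _ _ _ _ (fP x) IH) => F T _ _; rewrite big_cons px.
by apply: eq_positive IH => F T _ _; rewrite big_cons px.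
Qed.

Definition positive_vec r (k : heights)
    (w : forall F : fieldType, (nat -> int -> int -> F) -> config -> F) : Prop :=
  forall S, positive_laurent r k (fun F T => w F T S).

(** The only subtraction in [fock] is in the determinant, and for these triangular matrices it
    reduces to the ratio of the two data at level [b]. *)
Lemma positive_fock r k (d c : nat -> bool) i b w : positive_vec r k w ->
  positive_vec r k (fun F T =>
    fock b (slab_mat (datum r T k i) (datum r T k (i + 1)) d c b) (w F T)).
Proof.
move=> wP S; have ratio b1 i1 b2 i2 :
    positive_laurent r k (fun F T => datum r T k i1 b1 / datum r T k i2 b2).
  by apply: positiveM; [apply: positive_datum | apply: positive_datumV].
rewrite /fock /slab_mat; case: (d b); case: (S b); case: (S b.+1) => /=.
- apply: positiveM => //; apply: eq_positive (ratio b i b (i + 1)) => F T _ _.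
  by rewrite mulr1 mulr0 subr0.
- apply: positiveD; apply: positiveM => //.
  by case: (c b).
- apply: eq_positive (wP S) => F T _ _.
  by rewrite mul0r add0r mul1r.
- exact: wP.
- apply: positiveM => //; apply: eq_positive (ratio b i b (i + 1)) => F T _ _.
  by rewrite mul1r mul0r subr0.
- apply: eq_positive (wP S) => F T _ _.
  by rewrite mul0r addr0 mul1r.
- apply: positiveD; apply: positiveM => //.
  by case: (c b.+1).
- exact: wP.
Qed.

Lemma positive_strip r k i w : positive_vec r k w ->
  positive_vec r k (fun F T => strip r T k i (w F T)).
Proof.
move=> wP; rewrite /strip /slab; move: (upward k i) (order_bit k i) => d c.
suff gen n : positive_vec r k (fun F T =>
    word (slab_mat (datum r T k i) (datum r T k (i + 1)) d c) c n (w F T)).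
  by [].
elim: n w wP => //= n IH w wP.
case: (c n.+1); first exact/IH/positive_fock.
by apply: positive_fock; apply: IH.
Qed.

Lemma positive_strips r k L N w : positive_vec r k w ->
  positive_vec r k (fun F T => strips r T k L N (w F T)).
Proof. by move=> wP; elim: N L => //= N IH L; apply: positive_strip. Qed.

Lemma positive_ground_vec r k a : positive_vec r k (fun F _ => ground_vec r a).
Proof.
move=> S; rewrite /ground_vec.
by case: (agree r a S); [apply: positive1 | apply: positive0].
Qed.

(** Periodicity makes the two lines of slope one descending from the target at level [a] meet the
    surface, at distances [M] and [N]; [cone_formula] then has only positive factors. *)
Lemma positive_above r k (a : nat) (j h : int) :
  stepped_surface r k -> two_periodic r k -> (1 <= a <= r)%N -> even_idx a j h ->
  k a j <= h -> positive_laurent r k (fun F T => T a j h).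
Proof.
move=> sk per ar eh kh; have := sk; rewrite stepped_surfaceE => -[ev _ st].
have {}per (i : int) : k a (i + 2) = k a i by apply: per.
have perL (n : nat) : k a (j - (2 * n)%N%:Z) = k a j.
  elim: n => [|n IH]; first by rewrite muln0 subr0.
  by rewrite -IH -per; congr (k a _); lia.
have perR (n : nat) : k a (j + (2 * n)%N%:Z) = k a j.
  elim: n => [|n IH]; first by rewrite muln0 addr0.
  by rewrite -IH -[RHS]per; congr (k a _); lia.
have [M EM leM] : exists2 M : nat, k a (j - M%:Z) + M%:Z = h &
    forall n, (n <= M)%N -> k a (j - n%:Z) + n%:Z <= h.
  apply: (first_crossing (fun n => k a (j - n%:Z))) => [|n|n|n].
  - by rewrite subr0.
  - by move: (ev a (j - n%:Z) ar) eh; rewrite /even_idx; clear; lia.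
  - have := st a (j - n.+1%:Z) ar.
    have -> : j - n.+1%:Z + 1 = j - n%:Z by lia.
    by clear; lia.
  - by rewrite perL subr0.
have [N EN leN] : exists2 N : nat, k a (j + N%:Z) + N%:Z = h &
    forall n, (n <= N)%N -> k a (j + n%:Z) + n%:Z <= h.
  apply: (first_crossing (fun n => k a (j + n%:Z))) => [|n|n|n].
  - by rewrite addr0.
  - by move: (ev a (j + n%:Z) ar) eh; rewrite /even_idx; clear; lia.
  - have := st a (j + n%:Z) ar.
    have -> : j + n%:Z + 1 = j + n.+1%:Z by lia.
    by clear; lia.
  - by rewrite perR addr0.
apply: eq_positive => [F T Ts nz|]; first exact: (cone_formula r T k a j h M N).
apply: positiveM; last by apply: positive_prod => b; apply: positive_datum.
apply: positiveM; first exact/positive_strips/positive_ground_vec.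
apply: eq_positive => [F T _ _|]; first by rewrite /datum_prod -prodfV.
by apply: positive_prod => b; apply: positive_datumV.
Qed.

Theorem mainTheorem7 (r : nat) (kk : nat -> int -> int) :
  (1 <= r)%N -> stepped_surface r kk -> two_periodic r kk ->
  forall (a : nat) (j k : int), (1 <= a <= r)%N -> even_idx a j k ->
  exists P : laurent, lvars_in r P /\
    forall (F : fieldType) (T : nat -> int -> int -> F),
      Tsystem r T ->
      (forall b i l, (1 <= b <= r)%N -> even_idx b i l -> T b i l != 0) ->
      T a j k = leval (fun b i => T b i (kk b i)) P.
Proof.
move=> _ sk per a j h ar eh.
have [kh|hk] := leP (kk a j) h; first exact: positive_above.
have even_opp (b : nat) (i l : int) : even_idx b i (- l) = even_idx b i l.
  by rewrite /even_idx; lia.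
have sk' : stepped_surface r (fun b i => - kk b i).
  move: sk; rewrite !stepped_surfaceE => -[ev st1 st2]; split=> b i br.
  - by rewrite even_opp; apply: ev.
  - by move: (st1 b i br); clear; lia.
  - by move: (st2 b i br); clear; lia.
have per' : two_periodic r (fun b i => - kk b i) by move=> b i br; rewrite per.
have [||P [vP EP]] := positive_above r _ a j (- h) sk' per' ar.
- by rewrite even_opp.
- by rewrite lerN2 ltW.
exists P; split=> // F T Ts nz.
have [Trec T0 Tr] := TsystemP _ _ Ts.
(* The reflection only swaps the two factors on the left of the T-system relation. *)
have /EP : Tsystem r (fun b i l => T b i (- l)).
  split=> [b i l br el|i l el|i l el].
  - rewrite -Trec ?even_opp // mulrC.
    by congr (T _ _ _ * T _ _ _); lia.
  - by rewrite T0 ?even_opp.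
  - by rewrite Tr ?even_opp.
rewrite opprK => ->; last by move=> b i l br el; apply: nz; rewrite ?even_opp.
rewrite /leval; apply: eq_bigr => m _; congr (_ * _); apply: eq_bigr => v _.
by rewrite opprK.
Qed.
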